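(* Let $N\ge2$ and let $\Omega_1\ge\dots\ge\Omega_N$ be real numbers, not all zero, with $\sum_j\Omega_j=0$. At the critical value $\kappa=\kappa^*$ (see context) the angle of opening $\alpha_1-\alpha_N$ of the phase-locked state satisfies $$\pi>2\cos^{-1}\left(\frac{-N+2+\sqrt{N^2-4N+36}}{8}\right)\ge\alpha_1-\alpha_N\ge\frac\pi2,$$ where the value $\frac\pi2$ is only achieved when there are only two distinct natural frequencies, so that for some $1\le j<N$ we have $\Omega_1=\dots=\Omega_j=M_1$ and $\Omega_{j+1}=\dots=\Omega_N=-M_2$ with $jM_1=(N-j)M_2$. Furthermore, the value $\lambda^*$ of the order parameter norm at the critical value $\kappa^*$ satisfies $$\frac{1+(N-1)^2}{N\sqrt{(N-1)^2+1}}\ge\lambda^*\ge\frac{\sqrt2}{2},$$ and, with $j$ denoting the index in the two-frequency configuration just described, $\lambda^*$ is minimal only when $N$ is even and $j=\frac N2$, and maximal when $j=1$.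
   Context: A phase-locked state at coupling $\kappa>0$ consists of angles $\alpha_j$ with $\cos\alpha_j\ge0$ (the potentially stable ones) and $\lambda>0$ such that $$\Omega_j=\lambda\kappa\sin\alpha_j,\qquad\lambda=\frac1N\sum_{l=1}^N\cos\alpha_l,\qquad\frac1N\sum_{l=1}^N\sin\alpha_l=0;$$ it corresponds to the fixed point $z_{jk}=e^{i(\alpha_j-\alpha_k)}$ of the Schrödinger-Lohe correlation system $\dot z_{jk}=i(\Omega_j-\Omega_k)z_{jk}+\frac{\kappa}{2N}\sum_l(z_{jl}+z_{lk})(1-z_{jk})$, with $\lambda=\|\zeta_\infty\|_2$ the norm of the order parameter $\zeta_\infty$. The critical coupling $\kappa^*$ is the coupling at which the stable branch of phase-locked states begins (the branch along which $\lambda$ increases with $\kappa$, with $\lambda\to1$, $\alpha_j\to0$ as $\kappa\to\infty$). It is characterized by the phase-locked state at $\kappa=\kappa^*$ satisfying $$\lambda=\frac1N\sum_{j=1}^N\cos\alpha_j=\frac1{2N}\sum_{j=1}^N\frac1{\cos\alpha_j}=:\lambda^*.$$ *)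

(* Defs.v *)
From HB Require Import structures.
From mathcomp Require Import all_boot all_order all_algebra.
From mathcomp Require Import all_classical all_reals all_analysis.
Set Implicit Arguments.
Unset Strict Implicit.
Unset Printing Implicit Defensive.
Import Order.TTheory GRing.Theory Num.Theory.
Import numFieldNormedType.Exports.
Local Open Scope classical_set_scope.
Local Open Scope ring_scope.

(* Particles 1, ..., N are represented by the ordinals 0, ..., N - 1. *)
Definition first_idx (N : nat) (hN : (2 <= N)%N) : 'I_N := Ordinal (ltnW hN).
Definition last_idx (N : nat) (hN : (2 <= N)%N) : 'I_N :=
  rev_ord (first_idx hN).

Definition opening (R : realType) (N : nat) (hN : (2 <= N)%N)
    (alpha : 'I_N -> R) : R :=
  alpha (first_idx hN) - alpha (last_idx hN).

Definition phase_locked (R : realType) (N : nat) (Omega : 'I_N -> R)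
    (kappa lambda : R) (alpha : 'I_N -> R) : Prop :=
  [/\ 0 < kappa /\ 0 < lambda,
      forall j, 0 <= cos (alpha j),
      forall j, Omega j = lambda * kappa * sin (alpha j),
      lambda = N%:R^-1 * \sum_(l < N) cos (alpha l) &
      N%:R^-1 * \sum_(l < N) sin (alpha l) = 0].

(* Continuity, the sign condition on the cosines and the limit 0 at +oo
   together force the angles to be the representatives in [-pi/2, pi/2]. *)
Definition stable_branch (R : realType) (N : nat) (Omega : 'I_N -> R)
    (kappa0 : R) (lambda : R -> R) (alpha : R -> 'I_N -> R) : Prop :=
  [/\ forall kappa, kappa0 <= kappa ->
        phase_locked Omega kappa (lambda kappa) (alpha kappa),
      forall j, {within `[kappa0, +oo[, continuous (fun kappa => alpha kappa j)},
      forall kappa1 kappa2, kappa0 <= kappa1 -> kappa1 < kappa2 ->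
        lambda kappa1 < lambda kappa2,
      lambda kappa @[kappa --> +oo] --> (1 : R) &
      forall j, alpha kappa j @[kappa --> +oo] --> (0 : R)].

(* The stable branch begins at kappas, with the phase-locked state
   (lambdas, alphas) as its starting point: it is defined from kappas on, and
   from no smaller coupling. *)
Definition critical_state (R : realType) (N : nat) (Omega : 'I_N -> R)
    (kappas lambdas : R) (alphas : 'I_N -> R) : Prop :=
  (exists (lambda : R -> R) (alpha : R -> 'I_N -> R),
    [/\ stable_branch Omega kappas lambda alpha,
        lambda kappas = lambdas &
        forall j, alpha kappas j = alphas j]) /\
  (forall kappa0, kappa0 < kappas ->
    ~ exists (lambda : R -> R) (alpha : R -> 'I_N -> R),
        stable_branch Omega kappa0 lambda alpha).

(* Omega_1 = ... = Omega_j = M1 and Omega_(j+1) = ... = Omega_N = - M2. *)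
Definition two_frequencies (R : realType) (N : nat) (Omega : 'I_N -> R)
    (j : nat) (M1 M2 : R) : Prop :=
  [/\ (1 <= j < N)%N,
      M1 != - M2,
      forall i : 'I_N, (i < j)%N -> Omega i = M1,
      forall i : 'I_N, (j <= i)%N -> Omega i = - M2 &
      j%:R * M1 = (N - j)%:R * M2].

(* Main.v *)
(* With s = 1 / (lambda kappa) a phase-locked state has sin alpha_j = Omega_j s,
   and kappa^-1 = s * C(s) where C(s) is the mean of sqrt(1 - (Omega_j s)^2).
   This function of s is strictly concave, and the stable branch is its
   increasing part; it therefore begins at the maximum, where
   sum_j (2 cos alpha_j - 1 / cos alpha_j) = 0.

   At that point put x_j = sin alpha_j, c_j = cos alpha_j and S = sum_j c_j.
   For the weights c_j / S the tangents y_j = x_j / c_j have mean 0 and variance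
   1, so averaging (y_j - y_N) (y_1 - y_j) >= 0 gives y_1 y_N <= -1, that is
   cos (alpha_1 - alpha_N) <= 0, with equality only if all y_j are extreme.  The
   upper bound on the opening follows from 2 c - 1/c <= 1 for the other N - 2
   angles.  The bound 2 S^2 >= N^2 is sum_j (c_j - S/N)^2 / c_j >= 0, and
   S^2 <= (N-1)^2 + 1 is obtained by isolating the smallest cosine and
   controlling the dispersion of the N - 1 other unit vectors by
   (N-1)^2 - |their sum|^2. *)
Require Import Defs.
From HB Require Import structures.
From mathcomp Require Import all_boot all_order all_algebra.
From mathcomp Require Import all_classical all_reals all_analysis.
From mathcomp Require Import ring lra.
Import Order.TTheory GRing.Theory Num.Theory.
Import numFieldNormedType.Exports.
Local Open Scope ring_scope.

(** * Polynomial inequalities behind the upper bound on the sum of the cosines *)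

(** In the next two lemmas [2 * S * c = 2 + T + V], so this bound is [T + V <= 1 / 2]. The last
    hypothesis comes from summing [c * (1 / c_j - 1) <= 1 - c_j] over all [j], where [c] is the
    smallest cosine. *)
Lemma excess_le_half (R : realFieldType) (m S c : R) :
  2 <= m -> m ^+ 2 + 1 < S ^+ 2 -> 0 < S ->
  c * (2 * S - (m + 1)) <= m + 1 - S -> S * c <= 5 / 4.
Proof.
move=> m2 hS S0 hc.
have mS : m < S by nra.
set d := S - m.
have Sd : S = m + d by rewrite /d; ring.
have hd : 1 < d * (2 * m + d) by rewrite Sd in hS; nra.
have d0 : 0 < d by rewrite /d; lra.
have den : 0 < 2 * S - (m + 1) by lra.
rewrite -(ler_pM2r den).
have h1 : S * (c * (2 * S - (m + 1))) <= S * (m + 1 - S) by rewrite ler_pM2l.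
have h2 : 4 * (S * (m + 1 - S)) <= 5 * (2 * S - (m + 1)).
  have h3 : 4 * d * (m + d) >= 2.
    have -> : 4 * d * (m + d) = 2 * (d * (2 * m + d)) + 2 * d ^+ 2 by ring.
    have := sqr_ge0 d; lra.
  rewrite Sd.
  have [m3|m3] := lerP 3 m; first by nra.
  (* For [m < 3], [hd] gives [d * (6 + d) > 1], so [d] exceeds sqrt 10 - 3; [1/7] is a rational
     number just below that. *)
  have h4 : 1/7 < d by rewrite ltNge; apply/negP => h; nra.
  nra.
rewrite mulrA in h1; lra.
Qed.

(* Here c is the smallest cosine, g the sum of the other m, and V = m^2 - |R|^2
   where R is the sum of the unit vectors of the other angles.  Everything is
   polynomial in m, V and T = S^2 - m^2 - 1, because 2 S c = 2 + T + V. *)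
Lemma no_excess_ge3 (R : realFieldType) (m S c g V : R) :
  3 <= m -> m ^+ 2 + 1 < S ^+ 2 -> 0 < S -> g = S - c ->
  V = m ^+ 2 - g ^+ 2 - (1 - c ^+ 2) -> 0 <= V ->
  c * (2 * S - (m + 1)) <= m + 1 - S ->
  g ^+ 2 * (2 * S * c - 1) - g * m ^+ 2 * c <= m * V -> False.
Proof.
move=> m3 hS S0 hg hV V0 hc hB.
have Sc : S * c <= 5 / 4 by apply: (@excess_le_half R m) => //; lra.
pose T := S ^+ 2 - m ^+ 2 - 1.
have T0 : 0 < T by rewrite /T; lra.
have e1 : 2 * S * c = 2 + T + V by rewrite hV hg /T; ring.
have W12 : T + V <= 1 / 2 by lra.
pose G := 2 * m ^+ 2 + T - V.
have eG : 2 * S * g = G.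
  have -> : 2 * S * g = 2 * S ^+ 2 - 2 * S * c by rewrite hg; ring.
  by rewrite e1 /G /T; ring.
have eS : S ^+ 2 = m ^+ 2 + 1 + T by rewrite /T; ring.
have {}hB : G * (m ^+ 2 * (T + V) + T - V + T ^+ 2 - V ^+ 2)
    <= 4 * m * V * (m ^+ 2 + 1 + T).
  have S20 : 0 < 4 * S ^+ 2 by nra.
  move: hB; rewrite -(ler_pM2l S20).
  have -> : 4 * S ^+ 2 * (g ^+ 2 * (2 * S * c - 1) - g * m ^+ 2 * c) =
    (2 * S * g) ^+ 2 * (2 * S * c - 1) - (2 * S * g) * m ^+ 2 * (2 * S * c).
    by ring.
  rewrite e1 eG eS /G => h; lra.
have G1 : 2 * m ^+ 2 - 1 / 2 <= G by rewrite /G; lra.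
have B1 : m ^+ 2 * T + T + V * (m ^+ 2 - 3 / 2) <=
   m ^+ 2 * (T + V) + T - V + T ^+ 2 - V ^+ 2 by nra.
have m9 : 9 <= m ^+ 2 by nra.
have h1 : (2 * m ^+ 2 - 1 / 2) * (m ^+ 2 * T + T + V * (m ^+ 2 - 3 / 2)) <=
   4 * m * V * (m ^+ 2 + 1 + T).
  apply: le_trans hB; apply: ler_pM => //; first lra.
  have : 0 <= V * (m ^+ 2 - 3 / 2) by apply: mulr_ge0 => //; lra.
  have : 0 <= m ^+ 2 * T by apply: mulr_ge0; lra.
  lra.
(* The right side of [h1] is split. Its [V * T] term is absorbed by the [T] part of the left side
   because [V <= 1 / 2], strictly because [0 < T]; its remaining term, linear in [V], is absorbed by
   the [V] part, and this is where [3 <= m] is essential. *)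
have h2 : 4 * m * V * T <= 2 * m * T.
  have : 0 <= m * T by apply: mulr_ge0; lra.
  nra.
have h3 : 2 * m * T < (2 * m ^+ 2 - 1 / 2) * (m ^+ 2 * T + T).
  have -> : (2 * m ^+ 2 - 1 / 2) * (m ^+ 2 * T + T) =
    ((2 * m ^+ 2 - 1 / 2) * (m ^+ 2 + 1)) * T by ring.
  rewrite ltr_pM2r //; nra.
have h4 : 4 * m * (m ^+ 2 + 1) <= (2 * m ^+ 2 - 1 / 2) * (m ^+ 2 - 3 / 2).
  have e : (2 * m ^+ 2 - 1 / 2) * (m ^+ 2 - 3 / 2) - 4 * m * (m ^+ 2 + 1)
    = (m - 3) * (2 * m ^+ 3 + 2 * m ^+ 2 + 5 / 2 * m + 7 / 2) + 45 / 4 by field.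
  have : 0 <= (m - 3) * (2 * m ^+ 3 + 2 * m ^+ 2 + 5 / 2 * m + 7 / 2).
    apply: mulr_ge0; first lra.
    have : 0 <= m ^+ 3 by apply: exprn_ge0; lra.
    lra.
  lra.
have h5 : 4 * m * (m ^+ 2 + 1) * V <=
   (2 * m ^+ 2 - 1 / 2) * (m ^+ 2 - 3 / 2) * V.
  by apply: ler_wpM2r.
lra.
Qed.

(* The bound of no_excess_ge3 on the spread of the other cosines is too weak for
   m = 2; instead their product P is computed exactly from 2 h P = h^2 - x1^2,
   where x1 = - (x2 + x3) and 2 h = |e^(i a2) + e^(i a3)|^2. *)
Lemma no_excess_2 (R : realFieldType) (S c1 c2 c3 x2 x3 : R) :
  c2 ^+ 2 + x2 ^+ 2 = 1 -> c3 ^+ 2 + x3 ^+ 2 = 1 ->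
  c1 ^+ 2 + (x2 + x3) ^+ 2 = 1 ->
  0 < c1 -> 0 < c2 -> 0 < c3 -> S = c1 + c2 + c3 ->
  c1^-1 + c2^-1 + c3^-1 = 2 * S ->
  c1 * (2 * S - 3) <= 3 - S -> 5 < S ^+ 2 -> False.
Proof.
move=> h2 h3 h1 p1 p2 p3 eS hS hc S5.
have S0 : 0 < S by rewrite eS; lra.
have Sc : S * c1 <= 5 / 4.
  apply: (@excess_le_half R 2) => //; [lra|].
  by have -> : 2 + 1 = 3 :> R by ring.
pose P := c2 * c3; pose Q := x2 * x3; pose g := c2 + c3; pose h := 1 + P + Q.
have e1 : 2 * h * P = h ^+ 2 - (x2 + x3) ^+ 2.
  have -> : h ^+ 2 = 2 * h * P + (1 + Q) ^+ 2 - P ^+ 2 by rewrite /h; ring.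
  have -> : P ^+ 2 = (1 - x2 ^+ 2) * (1 - x3 ^+ 2).
    have -> : 1 - x2 ^+ 2 = c2 ^+ 2 by rewrite -h2; ring.
    have -> : 1 - x3 ^+ 2 = c3 ^+ 2 by rewrite -h3; ring.
    by rewrite /P; ring.
  rewrite /Q; ring.
have e2 : g * c1 = (2 * S * c1 - 1) * P.
  by rewrite -hS /g /P; field; rewrite !gt_eqF.
have e3 : 2 * h = g ^+ 2 + (x2 + x3) ^+ 2.
  have -> : 2 * h = (c2 ^+ 2 + x2 ^+ 2) + (c3 ^+ 2 + x3 ^+ 2) + 2 * P + 2 * Q.
    by rewrite h2 h3 /h; ring.
  by rewrite /g /P /Q; ring.
pose T := S ^+ 2 - 5; pose V := 4 - 2 * h.
have T0 : 0 < T by rewrite /T; lra.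
have V0 : 0 <= V.
  have := sqr_ge0 (c2 - c3); have := sqr_ge0 (x2 - x3).
  rewrite /V /h /P /Q; nra.
have gS : g = S - c1 by rewrite eS /g; ring.
have e4 : 2 * S * c1 = 2 + T + V.
  have -> : V = 4 - (g ^+ 2 + (1 - c1 ^+ 2)) by rewrite /V e3 -h1; ring.
  by rewrite gS /T; ring.
have W12 : T + V <= 1 / 2 by lra.
have e5 : g * c1 * (2 * h) = (2 * S * c1 - 1) * (h ^+ 2 - 1 + c1 ^+ 2).
  rewrite e2 -mulrA [P * _]mulrC e1; congr (_ * _).
  have -> : (x2 + x3) ^+ 2 = 1 - c1 ^+ 2 by rewrite -h1; ring.
  by ring.
have eh : h = (4 - V) / 2 by rewrite /V; field.
have eS2 : S ^+ 2 = 5 + T by rewrite /T; ring.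
have e6 : (4 - V) * (8 + T - V) * (2 + T + V) =
  (1 + T + V) * ((5 + T) * ((4 - V) ^+ 2 - 4) + (2 + T + V) ^+ 2).
  have eg : 2 * S * g = 8 + T - V.
    have -> : 2 * S * g = 2 * S ^+ 2 - 2 * S * c1 by rewrite gS; ring.
    by rewrite e4 eS2; ring.
  (* The factor [4 * S ^+ 2] leaves only [2 * S * g], [2 * S * c1], [2 * h] and [S ^+ 2], all
     polynomials in [T] and [V]. *)
  have := congr1 (fun z => 4 * S ^+ 2 * z) e5.
  rewrite /=.
  have -> : 4 * S ^+ 2 * (g * c1 * (2 * h)) = (2 * S * g) * (2 * S * c1) * (2 * h).
    by ring.
  have -> : 4 * S ^+ 2 * ((2 * S * c1 - 1) * (h ^+ 2 - 1 + c1 ^+ 2)) =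
    (2 * S * c1 - 1) * (S ^+ 2 * ((2 * h) ^+ 2 - 4) + (2 * S * c1) ^+ 2) by ring.
  rewrite e4 eg eS2 eh => e.
  have -> : (4 - V) * (8 + T - V) * (2 + T + V) =
    (8 + T - V) * (2 + T + V) * (2 * ((4 - V) / 2)) by field.
  by rewrite e; field.
pose rhs := (1 + T + V) * ((5 + T) * ((4 - V) ^+ 2 - 4) + (2 + T + V) ^+ 2).
(* By [e6] this difference is zero. At [T = 0] it reduces to [5 * V * (2 - V) ^+ 2], and the
   cofactor of [T] is positive since [V <= 1 / 2]. *)
have : 0 < rhs - (4 - V) * (8 + T - V) * (2 + T + V).
  have -> : rhs - (4 - V) * (8 + T - V) * (2 + T + V) = 5 * V * (2 - V) ^+ 2
    + T * (40 - 16 * V + V ^+ 2 + V ^+ 3 + T * (13 - 4 * V + V ^+ 2) + T ^+ 2).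
    by rewrite /rhs; ring.
  apply: ltr_wpDl; first by apply: mulr_ge0; [lra|exact: sqr_ge0].
  apply: mulr_gt0 => //.
  have V2 := sqr_ge0 V.
  have V3 : 0 <= V ^+ 3 by apply: exprn_ge0.
  have : 0 <= T * (13 - 4 * V + V ^+ 2) by apply: mulr_ge0; lra.
  have := sqr_ge0 T; lra.
rewrite e6 subrr ltxx //.
Qed.

(** * Angles with critical cosines *)

Section CriticalCosines.
Variables (R : realFieldType) (N : nat) (x c : 'I_N -> R).
Hypothesis c_gt0 : forall j, 0 < c j.
Hypothesis cx1 : forall j, c j ^+ 2 + x j ^+ 2 = 1.
Hypothesis sum_x : \sum_j x j = 0.
Hypothesis sum_invc : \sum_j (c j)^-1 = 2 * \sum_j c j.
Let S := \sum_j c j.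

Let c_neq0 j : c j != 0. Proof. by rewrite gt_eqF. Qed.

Lemma unit_cosine_le1 j : c j <= 1.
Proof. have := cx1 j; have := c_gt0 j; have := sqr_ge0 (x j); nra. Qed.

Lemma sum_cos_gt0 : (0 < N)%N -> 0 < S.
Proof.
move=> N0; rewrite /S (bigD1 (Ordinal N0)) //=.
by apply: ltr_wpDr => //; apply: sumr_ge0 => j _; exact: ltW.
Qed.

Lemma sum_sqr_dev_over (r : R) :
  \sum_j (c j - r) ^+ 2 / c j = S * (1 + 2 * r ^+ 2) - 2 * r * N%:R.
Proof.
transitivity (\sum_j (c j - 2 * r + r ^+ 2 * (c j)^-1)).
  by apply: eq_bigr => j _; field.
rewrite !big_split /= -mulr_sumr sum_invc sumr_const card_ord -/S -mulr_natr; ring.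
Qed.

Lemma sum_cos_ge : (0 < N)%N -> N%:R ^+ 2 <= 2 * S ^+ 2.
Proof.
move=> N0.
have S0 : 0 < S by exact: sum_cos_gt0.
have : 0 <= \sum_j (c j - S / N%:R) ^+ 2 / c j.
  by apply: sumr_ge0 => j _; rewrite divr_ge0 ?sqr_ge0 // ltW.
have N0' : 0 < N%:R :> R by rewrite ltr0n.
rewrite sum_sqr_dev_over.
have -> : S * (1 + 2 * (S / N%:R) ^+ 2) - 2 * (S / N%:R) * N%:R =
  S * (2 * S ^+ 2 - N%:R ^+ 2) / N%:R ^+ 2 by field; rewrite gt_eqF.
rewrite pmulr_lge0 ?invr_gt0 ?exprn_gt0 // pmulr_rge0 // subr_ge0 //.
Qed.

Lemma sum_cos_eq : (0 < N)%N -> 2 * S ^+ 2 = N%:R ^+ 2 ->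
  forall j, c j = S / N%:R.
Proof.
move=> N0 hS j.
have N0' : N%:R != 0 :> R by rewrite pnatr_eq0 -lt0n.
have : \sum_j (c j - S / N%:R) ^+ 2 / c j = 0.
  rewrite sum_sqr_dev_over.
  have -> : S * (1 + 2 * (S / N%:R) ^+ 2) - 2 * (S / N%:R) * N%:R =
    S * (2 * S ^+ 2 - N%:R ^+ 2) / N%:R ^+ 2 by field.
  by rewrite hS subrr mulr0 mul0r.
move/eqP; rewrite psumr_eq0; last first.
  by move=> k _; rewrite divr_ge0 ?sqr_ge0 // ltW.
move=> /allP /(_ j (mem_index_enum _)) /=.
by rewrite mulf_eq0 invr_eq0 (negbTE (c_neq0 j)) orbF sqrf_eq0 subr_eq0 => /eqP.
Qed.

(* Weighted by c, the tangents x / c have mean 0 and variance 1. *)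
Lemma sum_weighted_tangent (a b : R) :
  \sum_j c j * ((x j / c j - b) * (a - x j / c j)) = - S * (1 + a * b).
Proof.
transitivity (\sum_j ((a + b) * x j - ((c j)^-1 - c j) - a * b * c j)).
  apply: eq_bigr => j _.
  have -> : (c j)^-1 - c j = x j ^+ 2 / c j.
    have -> : x j ^+ 2 = 1 - c j ^+ 2 by rewrite -(cx1 j); ring.
    by field.
  by field.
rewrite !sumrB -!mulr_sumr sum_x sum_invc -/S; ring.
Qed.

Lemma tangent_product_ge1 (a b : R) : (0 < N)%N ->
  (forall j, b <= x j / c j <= a) -> a * b <= -1.
Proof.
move=> N0 hab.
have S0 : 0 < S by exact: sum_cos_gt0.
have : 0 <= \sum_j c j * ((x j / c j - b) * (a - x j / c j)).
  apply: sumr_ge0 => j _; have /andP[h1 h2] := hab j.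
  by rewrite mulr_ge0 ?mulr_ge0 ?subr_ge0 // ltW.
rewrite sum_weighted_tangent; nra.
Qed.

Lemma tangent_product_eq1 (a b : R) :
  (forall j, b <= x j / c j <= a) -> a * b = -1 ->
  forall j, x j / c j = a \/ x j / c j = b.
Proof.
move=> hab ab j.
have : \sum_j c j * ((x j / c j - b) * (a - x j / c j)) = 0.
  by rewrite sum_weighted_tangent ab subrr mulr0.
move/eqP; rewrite psumr_eq0; last first.
  move=> i _; have /andP[h1 h2] := hab i.
  by rewrite mulr_ge0 ?mulr_ge0 ?subr_ge0 // ltW.
move=> /allP /(_ j (mem_index_enum _)) /=.
rewrite !mulf_eq0 (negbTE (c_neq0 j)) /= !subr_eq0.
by case/orP => /eqP ->; [right|left].
Qed.

(** The terms [2 * c j - (c j)^-1] sum to zero and none exceeds 1, so the other [N - 2] of them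
    contribute at most [N - 2]. *)
Lemma two_cosines_ge (i k : 'I_N) : i != k ->
  2 - N%:R <= (2 * c i - (c i)^-1) + (2 * c k - (c k)^-1).
Proof.
move=> ik.
have phi1 j : 2 * c j - (c j)^-1 <= 1.
  have : 1 <= (c j)^-1 by rewrite invf_ge1 ?unit_cosine_le1.
  have := unit_cosine_le1 j; lra.
have : \sum_j (2 * c j - (c j)^-1) = 0.
  by rewrite sumrB -mulr_sumr sum_invc subrr.
rewrite (bigD1 i) //= (bigD1 k) /=; last by rewrite eq_sym.
set s := \sum_(_ < _ | _) _ => h.
have : s <= N%:R - 2.
  apply: (@le_trans _ _ (\sum_(j < N | (j != i) && (j != k)) 1)).
    by apply: ler_sum.
  rewrite sumr_const.
  have -> : #|(fun j : 'I_N => (j != i) && (j != k))| = (N - 2)%N.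
    have := cardC (pred2 i k); rewrite card_ord card2 ik => h2.
    apply: (@addnI 2); rewrite subnKC; last by rewrite -h2 leq_addr.
    rewrite -[RHS]h2; congr (2 + _)%N.
    by apply: eq_card => j; rewrite !inE negb_or.
  rewrite natrB //.
  have := max_card (pred2 i k); by rewrite card2 ik card_ord.
lra.
Qed.

(* With c j1 minimal, convexity of 1/c and Cauchy-Schwarz for the remaining
   indices bound the sum of the remaining 1/c from above, while S larger than
   the claimed bound forces that sum to be large. *)
Lemma sum_cos_le : (2 <= N)%N -> S ^+ 2 <= (N%:R - 1) ^+ 2 + 1.
Proof.
move=> N2; rewrite leNgt; apply/negP => hS.
have N0 : (0 < N)%N by apply: leq_trans N2.
have S0 : 0 < S by exact: sum_cos_gt0.
pose j1 := [arg min_(j < Ordinal N0) c j]%O.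
have c1min j : c j1 <= c j.
  by rewrite /j1; case: arg_minP => // i _; apply.
set m : R := N%:R - 1 in hS *.
have cardm : \sum_(j < N | j != j1) (1 : R) = m.
  rewrite sumr_const cardC1 card_ord /m -subn1 natrB //.
have hc : c j1 * (2 * S - (m + 1)) <= m + 1 - S.
  have : \sum_j c j1 * ((c j)^-1 - 1) <= \sum_j (1 - c j).
    apply: ler_sum => j _.
    have -> : 1 - c j = c j * ((c j)^-1 - 1) by field.
    apply: ler_wpM2r => //; rewrite subr_ge0 invf_ge1 ?unit_cosine_le1 //.
  rewrite -mulr_sumr !sumrB sum_invc sumr_const card_ord -/S /m.
  by rewrite subrK.
have sx : \sum_(j | j != j1) x j = - x j1.
  by move: sum_x; rewrite (bigD1 j1) //= => /eqP; rewrite addrC addr_eq0 => /eqP.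
have sc : \sum_(j | j != j1) c j = S - c j1.
  by rewrite /S [in RHS](bigD1 j1) //=; ring.
have si : \sum_(j | j != j1) (c j)^-1 = 2 * S - (c j1)^-1.
  by rewrite -sum_invc [in RHS](bigD1 j1) //=; ring.
set g := S - c j1 in sc.
have sc2 : \sum_(j | j != j1) c j ^+ 2 = m - \sum_(j | j != j1) x j ^+ 2.
  rewrite -cardm -sumrB; apply: eq_bigr => j _; rewrite -(cx1 j); ring.
have m_ge1 : 1 <= m.
  have : 2 <= N%:R :> R by rewrite ler_nat.
  rewrite /m; lra.
(* Cauchy-Schwarz for the sines. The dispersions of the remaining sines and cosines add up to
   [m * V]; discarding the nonnegative one of the sines gives [hV]. *)
have hx : x j1 ^+ 2 <= m * \sum_(j | j != j1) x j ^+ 2.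
  have : 0 <= \sum_(j | j != j1) (m * x j + x j1) ^+ 2.
    by apply: sumr_ge0 => j _; exact: sqr_ge0.
  have -> : \sum_(j | j != j1) (m * x j + x j1) ^+ 2 =
      m * (m * (\sum_(j | j != j1) x j ^+ 2) - x j1 ^+ 2).
    transitivity (\sum_(j | j != j1)
        (m ^+ 2 * x j ^+ 2 + 2 * m * x j1 * x j + x j1 ^+ 2 * 1)).
      by apply: eq_bigr => j _; ring.
    by rewrite !big_split /= -!mulr_sumr sx cardm; ring.
  by rewrite pmulr_rge0 ?subr_ge0 //; lra.
pose V := m ^+ 2 - g ^+ 2 - (1 - c j1 ^+ 2).
have hV : \sum_(j | j != j1) (m * c j - g) ^+ 2 <= m * V.
  have -> : \sum_(j | j != j1) (m * c j - g) ^+ 2 =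
      m * (m * (\sum_(j | j != j1) c j ^+ 2) - g ^+ 2).
    transitivity (\sum_(j | j != j1)
        (m ^+ 2 * c j ^+ 2 - 2 * m * g * c j + g ^+ 2 * 1)).
      by apply: eq_bigr => j _; ring.
    by rewrite !big_split /= sumrN -!mulr_sumr sc cardm; ring.
  rewrite ler_pM2l; last lra.
  rewrite sc2 /V -(cx1 j1); lra.
have V0 : 0 <= V.
  rewrite -(pmulr_rge0 V (lt_le_trans ltr01 m_ge1)).
  by apply: le_trans hV; apply: sumr_ge0 => j _; exact: sqr_ge0.
case: (ltngtP N 2) => [|N3|N2']; first by rewrite ltnNge N2.
- case: (ltngtP N 3) => [|N4|N3'].
  + by rewrite ltnNge N3.
  + apply: (@no_excess_ge3 R m S (c j1) g V) => //; try lra.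
      have : 4 <= N%:R :> R by rewrite ler_nat.
      rewrite /m; lra.
    apply: le_trans hV.
    (* Dividing each square by [c j] brings in the sum of inverses [si]; the factor [c j1 / c j] is
       at most 1 by minimality of [c j1]. *)
    have -> : g ^+ 2 * (2 * S * c j1 - 1) - g * m ^+ 2 * c j1 =
        \sum_(j | j != j1) c j1 * ((m * c j - g) ^+ 2 / c j).
      transitivity (\sum_(j | j != j1) c j1 *
          (m ^+ 2 * c j - 2 * m * g * 1 + g ^+ 2 * (c j)^-1)).
        rewrite -mulr_sumr !big_split /= sumrN -!mulr_sumr sc cardm si.
        by field.
      by apply: eq_bigr => j _; congr (_ * _); field.
    apply: ler_sum => j _.
    rewrite mulrCA -[leRHS]mulr1; apply: ler_wpM2l; first exact: sqr_ge0.
    by rewrite ler_pdivrMr // mul1r.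
  + have /cards2P[k [l [kl E]]] : #|[set~ j1]| == 2%N by rewrite cardsC1 card_ord N3'.
    have sumkl (F : 'I_N -> R) : \sum_(j | j != j1) F j = F k + F l.
      transitivity (\sum_(j in [set~ j1]) F j).
        by apply: eq_bigl => j; rewrite !inE.
      by rewrite E big_setU1 ?inE //= big_set1.
    move: sx sc si; rewrite !sumkl => sx sc si.
    have em : m = 2 by rewrite /m N3'; ring.
    apply: (@no_excess_2 R S (c j1) (c k) (c l) (x k) (x l)) => //.
    * by rewrite sx sqrrN.
    * by rewrite -addrA sc /g; ring.
    * by rewrite -addrA si; ring.
    * by move: hc; rewrite em; lra.
    * by move: hS; rewrite em; lra.
- have em : m = 1 by rewrite /m N2'; ring.
  (* For two oscillators [V0] reads [S ^+ 2 <= 2 * S * c j1], hence [S * c j1 > 1]; then [hc]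
     multiplied by [S] gives [S ^+ 2 < 2]. *)
  move: hS hc V0; rewrite /V em /g => hS hc V0.
  have S1 : 1 < S by nra.
  have : S * (c j1 * (2 * S - (1 + 1))) <= S * (1 + 1 - S) by rewrite ler_pM2l.
  have : 1 < S * c j1 by nra.
  nra.
Qed.

(** The sines cancel, so [S] is the length of the sum of one unit vector and [m] equal ones.
    Criticality makes the two directions perpendicular, which is [e2], and Pythagoras gives the
    value: the bound of [sum_cos_le] is attained. *)
Lemma sum_cos_one_vs_rest (i : 'I_N) (y : R) : (2 <= N)%N -> y != 0 ->
  x i = (N%:R - 1) * y -> (forall j, j != i -> x j = - y) ->
  S ^+ 2 = (N%:R - 1) ^+ 2 + 1.
Proof.
move=> N2 y0 xi xj; set m : R := N%:R - 1 in xi *.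
have m1 : 1 <= m.
  have : 2 <= N%:R :> R by rewrite ler_nat.
  rewrite /m; lra.
have cardm : \sum_(j < N | j != i) (1 : R) = m.
  by rewrite sumr_const cardC1 card_ord /m -subn1 natrB // (leq_trans _ N2).
have [k ki] : exists k : 'I_N, k != i.
  apply/existsP; rewrite -negb_forall; apply/negP => /forallP h.
  have : \sum_(j < N | j != i) (1 : R) = 0.
    by apply: big_pred0 => j; rewrite (eqP (h j)) eqxx.
  rewrite cardm; lra.
have cj j : j != i -> c j = c k.
  move=> ji; apply/eqP; rewrite -(eqrXn2 (n := 2)) ?ltW //.
  apply/eqP; have := cx1 j; have := cx1 k; rewrite !xj //; lra.
have Se : S = c i + m * c k.
  rewrite /S (bigD1 i) //= -cardm mulr_suml; congr (_ + _).
  by apply: eq_bigr => j ji; rewrite cj // mul1r.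
have Ie : (c i)^-1 + m * (c k)^-1 = 2 * (c i + m * c k).
  rewrite -Se -sum_invc [RHS](bigD1 i) //= -cardm mulr_suml; congr (_ + _).
  by apply: eq_bigr => j ji; rewrite cj // mul1r.
have e1 : (c i ^+ 2 - x i ^+ 2) * c k + m * (c k ^+ 2 - y ^+ 2) * c i = 0.
  have -> : x i ^+ 2 = 1 - c i ^+ 2 by rewrite -(cx1 i); ring.
  have -> : y ^+ 2 = 1 - c k ^+ 2 by rewrite -(cx1 k) (xj k ki); ring.
  transitivity ((2 * (c i + m * c k) - ((c i)^-1 + m * (c k)^-1)) * (c i * c k)).
    by field; rewrite !c_neq0.
  by rewrite Ie subrr mul0r.
have e2 : c i * c k = m * y ^+ 2.
  apply/eqP; rewrite -subr_eq0.
  have : (c i * c k - m * y ^+ 2) * (y * (c i + m * c k)) = 0.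
    rewrite -[RHS](mulr0 y) -[in RHS]e1 xi; ring.
  move/eqP; rewrite mulf_eq0 => /orP[//|].
  rewrite mulf_eq0 (negbTE y0) /= gt_eqF //.
  by apply: addr_gt0 => //; apply: mulr_gt0 => //; lra.
have ci := cx1 i; have ck := cx1 k; rewrite (xj k ki) in ck; rewrite xi in ci.
have e3 : (m ^+ 2 + 1) * y ^+ 2 = 1.
  have : (c i * c k) ^+ 2 = (1 - (m * y) ^+ 2) * (1 - y ^+ 2).
    have -> : 1 - (m * y) ^+ 2 = c i ^+ 2 by rewrite -ci; ring.
    have -> : 1 - y ^+ 2 = c k ^+ 2 by rewrite -ck; ring.
    by ring.
  rewrite e2 => h; apply/eqP; rewrite -subr_eq0 -oppr_eq0; apply/eqP.
  transitivity ((1 - (m * y) ^+ 2) * (1 - y ^+ 2) - (m * y ^+ 2) ^+ 2); first ring.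
  by rewrite h subrr.
have -> : S ^+ 2 = c i ^+ 2 + 2 * m * (c i * c k) + m ^+ 2 * c k ^+ 2.
  by rewrite Se; ring.
rewrite e2.
have -> : c i ^+ 2 = 1 - (m * y) ^+ 2 by rewrite -ci; ring.
have -> : c k ^+ 2 = 1 - y ^+ 2 by rewrite -ck; ring.
by ring.
Qed.

End CriticalCosines.

(** * The stable branch *)

(* The tangent inequality of the concave function s |-> s * sqrt (1 - w s^2). *)
Section ChordTangent.
Variables (R : realFieldType) (w s t d c : R).
Hypotheses (w_ge0 : 0 <= w) (s_ge0 : 0 <= s) (t_ge0 : 0 <= t) (c_gt0 : 0 < c).
Hypotheses (dE : d ^+ 2 = 1 - w * s ^+ 2) (cE : c ^+ 2 = 1 - w * t ^+ 2).

(** The slope [2 * c - c^-1] is the derivative at [t]. Multiplied by [c], the gap between tangent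
    and function becomes a sum of two nonnegative terms. Only the square of [d] is prescribed, not
    its sign. *)
Let gapE : c * (t * c + (s - t) * (2 * c - c^-1) - s * d) =
  w * ((s - t) ^+ 2 * (2 * t + s)) / 2 + s * (c - d) ^+ 2 / 2.
Proof.
have -> : (c - d) ^+ 2 = c ^+ 2 + d ^+ 2 - 2 * c * d by ring.
transitivity (t * c ^+ 2 + (s - t) * (2 * c ^+ 2 - 1) - s * (c * d)).
  by field; rewrite gt_eqF.
by rewrite dE cE; field.
Qed.

Lemma term_le_tangent : s * d <= t * c + (s - t) * (2 * c - c^-1).
Proof.
rewrite -subr_ge0 -(pmulr_rge0 _ c_gt0) gapE.
by rewrite addr_ge0 // divr_ge0 // mulr_ge0 ?sqr_ge0 // mulr_ge0 ?sqr_ge0 //;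
  rewrite addr_ge0 // mulr_ge0.
Qed.

Lemma term_lt_tangent : 0 < w -> s != t ->
  s * d < t * c + (s - t) * (2 * c - c^-1).
Proof.
move=> w0 st; rewrite -subr_gt0 -(pmulr_rgt0 _ c_gt0) gapE.
have ts : 0 < 2 * t + s.
  have [s0|s0] := eqVneq s 0; last by rewrite ltr_wpDl ?mulr_ge0 // lt_neqAle eq_sym s0.
  by rewrite s0 addr0 mulr_gt0 // lt_neqAle t_ge0 -s0 st.
apply: ltr_wpDr; first by rewrite divr_ge0 // mulr_ge0 ?sqr_ge0.
rewrite divr_gt0 // mulr_gt0 // mulr_gt0 //.
by rewrite lt_neqAle sqr_ge0 eq_sym sqrf_eq0 subr_eq0 st.
Qed.

End ChordTangent.

Section StableBranch.
Local Open Scope classical_set_scope.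
Local Open Scope ring_scope.
Variables (R : realType) (N : nat) (Omega : 'I_N -> R).
Hypothesis Omega_neq0 : exists j, Omega j != 0.

(** [Num.sqrt] vanishes on negative numbers, so [0 < cosine s j] encodes that [Omega j * s] lies
    strictly between -1 and 1, and [cosine] is continuous on the whole line. *)
Definition cosine (s : R) (j : 'I_N) : R := Num.sqrt (1 - (Omega j * s) ^+ 2).
Definition coherence (s : R) : R := N%:R^-1 * \sum_j cosine s j.
(* N times the derivative of s * coherence s. *)
Definition slope (s : R) : R := \sum_j (2 * cosine s j - (cosine s j)^-1).

Let N_gt0 : (0 < N)%N.
Proof. by case: Omega_neq0 => j _; apply: leq_ltn_trans (ltn_ord j). Qed.

Lemma cosine0 j : cosine 0 j = 1.
Proof. by rewrite /cosine mulr0 expr0n subr0 sqrtr1. Qed.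

Lemma continuous_cosine j : continuous (cosine^~ j).
Proof.
move=> s; apply: (@continuous_comp _ _ _ (fun s => 1 - (Omega j * s) ^+ 2)).
  apply: cvgB; first exact: cvg_cst.
  apply: (@continuous_comp _ _ _ ( *%R (Omega j)) (fun x => x ^+ 2)).
    by apply: cvgMl_tmp; exact: cvg_id.
  exact: exprn_continuous.
exact: sqrt_continuous.
Qed.

Lemma continuous_coherence : continuous coherence.
Proof.
move=> s; apply: cvgMl_tmp; apply: cvg_big => [|i _]; first exact: add_continuous.
exact: continuous_cosine.
Qed.

Lemma continuous_slope s : (forall j, 0 < cosine s j) -> {for s, continuous slope}.
Proof.
move=> c0; apply: cvg_big => [|j _]; first exact: add_continuous.
apply: cvgB; first by apply: cvgMl_tmp; exact: continuous_cosine.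
by apply: cvgV; [rewrite gt_eqF|exact: continuous_cosine].
Qed.

Lemma cosine_gt0 s j : (0 < cosine s j) = ((Omega j * s) ^+ 2 < 1).
Proof. by rewrite sqrtr_gt0 subr_gt0. Qed.

Lemma ler_cosine (s t : R) j : 0 <= s -> s <= t -> cosine t j <= cosine s j.
Proof.
move=> s0 st; apply: ler_wsqrtr; rewrite lerD2l lerN2 !exprMn.
apply: ler_wpM2l; first exact: sqr_ge0.
by rewrite ler_sqr // nnegrE (le_trans s0).
Qed.

Lemma cosine_le_one s j : cosine s j <= 1.
Proof. by rewrite -[leRHS]sqrtr1 ler_wsqrtr // gerBl sqr_ge0. Qed.

Lemma slope_anti (s t : R) : 0 <= s -> s <= t -> (forall j, 0 < cosine t j) ->
  slope t <= slope s.
Proof.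
move=> s0 st c0; apply: ler_sum => j _.
have h := ler_cosine s t j s0 st.
apply: lerB; first by rewrite ler_wpM2l.
by rewrite lef_pV2 // posrE // (lt_le_trans (c0 j)).
Qed.

(** Intermediate value theorem for [slope]: it equals [N] at 0 and becomes negative near its first
    pole, where the cosine of a largest frequency vanishes. *)
Lemma exists_critical : exists2 t : R, 0 < t &
  (forall j, 0 < cosine t j) /\ slope t = 0.
Proof.
have [k k0] := Omega_neq0.
pose i := [arg max_(j > k) `|Omega j|]%O.
have maxi j : `|Omega j| <= `|Omega i|.
  by rewrite /i; case: arg_maxP => // l _; apply.
have Oi : 0 < `|Omega i| by apply: lt_le_trans (maxi k); rewrite normr_gt0.
have N1 : 1 <= N%:R :> R by rewrite ler1n.
(* At s1 the largest frequency has cosine 1 / (2 N), so its term in the slope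
   outweighs all the others, each of which is at most 1. *)
pose e : R := (2 * N%:R)^-1.
have e0 : 0 < e by rewrite invr_gt0 mulr_gt0 //; lra.
have e1 : e <= 1 / 2.
  by rewrite /e invfM mul1r ger_pMr ?invr_gt0 // invf_le1 //; lra.
have e2 : 0 <= 1 - e ^+ 2 by nra.
pose s1 := Num.sqrt (1 - e ^+ 2) / `|Omega i|.
have s10 : 0 <= s1 by rewrite divr_ge0 ?sqrtr_ge0.
have s1E : Omega i ^+ 2 * s1 ^+ 2 = 1 - e ^+ 2.
  rewrite -(real_normK (num_real (Omega i))) -exprMn /s1 mulrC divfK ?gt_eqF //.
  exact: sqr_sqrtr.
have Os j : (Omega j * s1) ^+ 2 <= 1 - e ^+ 2.
  rewrite exprMn -s1E ler_wpM2r ?sqr_ge0 //.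
  rewrite -(real_normK (num_real (Omega j))) -(real_normK (num_real (Omega i))).
  by rewrite ler_sqr ?nnegrE.
have c1 j : 0 < cosine s1 j.
  by rewrite cosine_gt0; apply: (le_lt_trans (Os j)); nra.
have ci : cosine s1 i = e.
  by rewrite /cosine exprMn s1E opprB addrCA subrr addr0 sqrtr_sqr gtr0_norm.
have sl0 : slope 0 = N%:R.
  rewrite /slope (eq_bigr (fun=> 1)) ?sumr_const ?card_ord //.
  by move=> j _; rewrite cosine0 invr1; ring.
have sl1 : slope s1 <= 0.
  rewrite /slope (bigD1 i) //= ci.
  have -> : e^-1 = 2 * N%:R by rewrite invrK.
  apply: (@le_trans _ _ (2 * e - 2 * N%:R + \sum_(j < N | j != i) 1)).
    rewrite lerD2l; apply: ler_sum => j _.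
    have : 1 <= (cosine s1 j)^-1 by rewrite invf_ge1 ?cosine_le_one.
    have := cosine_le_one s1 j; lra.
  rewrite sumr_const cardC1 card_ord -subn1 natrB //; lra.
have [t] : exists2 t, t \in `[0, s1] & slope t = 0.
  apply: IVT => //.
    apply: continuous_in_subspaceT => s; rewrite inE /= in_itv /= => /andP[s0 ss].
    apply: continuous_slope => j.
    exact: lt_le_trans (c1 j) (ler_cosine _ _ _ s0 ss).
  rewrite sl0 (min_idPr _) ?(max_idPl _) ?sl1 //=; lra.
rewrite in_itv /= => /andP[t0 ts] sl; exists t.
  rewrite lt_neqAle t0 andbT; apply/eqP => t0'.
  by move: sl; rewrite -t0' sl0; lra.
by split=> // j; exact: lt_le_trans (c1 j) (ler_cosine _ _ _ t0 ts).
Qed.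

Lemma sqr_cosine s j : 0 < cosine s j -> cosine s j ^+ 2 = 1 - Omega j ^+ 2 * s ^+ 2.
Proof.
by rewrite cosine_gt0 => h; rewrite sqr_sqrtr ?exprMn // subr_ge0 -exprMn ltW.
Qed.

(** The sum of the tangent inequalities, strict because some frequency is nonzero. Leaving [d]
    general allows the actual cosines of a phase-locked state in place of [cosine s]. *)
Lemma coherence_tangent (s t : R) (d : 'I_N -> R) : 0 <= s -> 0 <= t -> s != t ->
  (forall j, 0 < cosine t j) ->
  (forall j, d j ^+ 2 = 1 - Omega j ^+ 2 * s ^+ 2) ->
  s * (N%:R^-1 * \sum_j d j) < t * coherence t + (s - t) * (N%:R^-1 * slope t).
Proof.
move=> s0 t0 st c0 hd.
rewrite /coherence [t * _]mulrCA [(s - t) * _]mulrCA [ltLHS]mulrCA -mulrDr.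
rewrite ltr_pM2l ?invr_gt0 ?ltr0n // /slope !mulr_sumr -big_split /=.
have dE j := sqr_cosine t j (c0 j).
have [k k0] := Omega_neq0.
rewrite (bigD1 k) //= [ltRHS](bigD1 k) //=; apply: ltr_leD.
  by apply: (@term_lt_tangent _ (Omega k ^+ 2)); rewrite ?sqr_ge0 // exprn_even_gt0.
apply: ler_sum => j _.
by apply: (@term_le_tangent _ (Omega j ^+ 2)); rewrite ?sqr_ge0.
Qed.

(** The tangent is taken at the right end [u], where the slope is nonnegative because it is antitone
    and vanishes at [t]. *)
Lemma coherence_incr (t s u : R) : (forall j, 0 < cosine t j) -> slope t = 0 ->
  0 <= s -> s < u -> u <= t -> s * coherence s < u * coherence u.
Proof.
move=> c0 sl s0 su ut.
have u0 : 0 <= u by apply: ltW; apply: le_lt_trans su.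
have cu j : 0 < cosine u j by apply: lt_le_trans (c0 j) _; exact: ler_cosine.
have cs j : 0 < cosine s j.
  by apply: lt_le_trans (cu j) _; apply: ler_cosine => //; exact: ltW.
have h := coherence_tangent s u (cosine s) s0 u0 (negbT (lt_eqF su)) cu
  (fun j => sqr_cosine _ _ (cs j)).
 apply: (lt_le_trans h).
rewrite gerDl mulr_le0_ge0 ?subr_le0 ?(ltW su) //.
by rewrite mulr_ge0 ?invr_ge0 ?ler0n // -sl; exact: slope_anti.
Qed.

Lemma ltr_coherence (s u : R) : 0 <= s -> s < u -> (forall j, 0 < cosine u j) ->
  coherence u < coherence s.
Proof.
move=> s0 su cu; have u0 := le_lt_trans s0 su.
rewrite /coherence ltr_pM2l ?invr_gt0 ?ltr0n //.
have [k k0] := Omega_neq0.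
rewrite (bigD1 k) //= [ltRHS](bigD1 k) //=; apply: ltr_leD; last first.
  by apply: ler_sum => j _; apply: ler_cosine => //; exact: ltW.
have := cu k; rewrite cosine_gt0 => h.
rewrite ltr_sqrt; last first.
  rewrite subr_gt0; apply: le_lt_trans h; rewrite !exprMn.
  by rewrite ler_wpM2l ?sqr_ge0 // ler_sqr ?nnegrE // ltW.
rewrite ltrD2l ltrN2 !exprMn ltr_pM2l ?exprn_even_gt0 //.
by rewrite ltr_sqr ?nnegrE // ltW.
Qed.

Lemma coherence_gt0 (s : R) : (forall j, 0 < cosine s j) -> 0 < coherence s.
Proof.
move=> c0; rewrite mulr_gt0 ?invr_gt0 ?ltr0n //.
rewrite (bigD1 (Ordinal N_gt0)) //= ltr_wpDr //.
by apply: sumr_ge0 => j _; exact: ltW.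
Qed.

Lemma coherence0 : coherence 0 = 1.
Proof.
rewrite /coherence (eq_bigr (fun=> 1)) => [|j _]; last by rewrite cosine0.
by rewrite sumr_const card_ord mulVf // pnatr_eq0 -lt0n.
Qed.

(** Since [kappa^-1 = s * coherence s] increases on [[0, t]], it can be inverted there; the branch
    is this inverse [s], with angles [asin (Omega j * s)], and [kappa] going to infinity means [s]
    going to 0. *)
Lemma stable_branch_from_critical (t : R) : \sum_j Omega j = 0 -> 0 < t ->
  (forall j, 0 < cosine t j) -> slope t = 0 ->
  exists (lambda : R -> R) (alpha : R -> 'I_N -> R),
    stable_branch Omega (t * coherence t)^-1 lambda alpha.
Proof.
move=> sumO t0 c0 sl.
pose f u := u * coherence u.
have f_incr s u : 0 <= s -> s < u -> u <= t -> f s < f u.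
  exact: (coherence_incr t).
have ft0 : 0 < f t by rewrite mulr_gt0 ?coherence_gt0.
have cs s j : 0 <= s -> s <= t -> 0 < cosine s j.
  by move=> s0 st; apply: lt_le_trans (c0 j) _; exact: ler_cosine.
have cont_f : continuous f.
  by move=> u; apply: cvgM; [exact: cvg_id|exact: continuous_coherence].
have cont_ft : {within `[0, t], continuous f} by exact: continuous_subspaceT.
have f0 : f 0 = 0 by rewrite /f mul0r.
(* [g] selects a preimage under [f] in [[0, t]], with default value 0 where none exists; on
   [[0, f t]] it is the inverse of [f]. *)
pose g y := xget 0 [set u | u \in `[0, t] /\ f u = y].
have gP y : 0 <= y <= f t -> 0 <= g y <= t /\ f (g y) = y.
  move=> y0.
  have [u ut uy] : exists2 u, u \in `[0, t] & f u = y.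
    apply: IVT => //; first exact: ltW.
    by rewrite f0 (min_idPl _) ?(max_idPr _) // ltW.
  rewrite /g; case: xgetP => [z _ [] | /(_ u)]; first by rewrite in_itv.
  by case; split.
have gK : {in `[0, t], cancel f g}.
  move=> u; rewrite in_itv /= => /andP[u0 ut].
  have ftu v : 0 <= v -> v <= t -> f v <= f t.
    by move=> v0; rewrite le_eqVlt => /orP[/eqP->//|vt]; exact/ltW/f_incr.
  have : 0 <= f u <= f t.
    rewrite ftu // andbT mulr_ge0 // ltW //; apply: coherence_gt0 => j; exact: cs.
  move=> /gP[/andP[g0 gt] e].
  case: (ltgtP (g (f u)) u) => // h.
    by have := f_incr _ _ g0 h ut; rewrite e ltxx.
  by have := f_incr _ _ u0 h gt; rewrite e ltxx.
have cont_g : {within `[0, f t], continuous g}.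
  by rewrite -f0; apply: segment_can_le_continuous => //; exact: ltW.
pose s (k : R) := g k^-1.
have asin0 : asin 0 = 0 :> R.
  by rewrite -[in asin _]sin0 sinK // in_itv /= oppr_le0 divr_ge0 ?pi_ge0.
have k0 k : (f t)^-1 <= k -> 0 < k.
  by apply: lt_le_trans; rewrite invr_gt0.
have kV k : (f t)^-1 <= k -> 0 <= k^-1 <= f t.
  move=> h; rewrite invr_ge0 ltW ?k0 //=.
  by rewrite -[leRHS]invrK lef_pV2 // posrE ?invr_gt0 ?(k0 _ h).
have sP k : (f t)^-1 <= k -> [/\ 0 < s k, s k <= t & f (s k) = k^-1].
  move=> h; have [/andP[s0 st] e] := gP _ (kV _ h); split => //.
  rewrite lt_neqAle s0 andbT; apply/eqP => s0'.
  by move: e; rewrite -/(s k) -s0' f0 => /esym/eqP; rewrite invr_eq0 gt_eqF ?k0.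
have Os k j : (f t)^-1 <= k -> (Omega j * s k) ^+ 2 < 1.
  by move=> /sP[/ltW s0 st _]; rewrite -cosine_gt0; exact: cs.
have Os1 k j : (f t)^-1 <= k -> -1 < Omega j * s k < 1.
  by move=> h; have := Os _ j h; set y := _ * _ => y1; apply/andP; split; nra.
have Os1' k j : (f t)^-1 <= k -> -1 <= Omega j * s k <= 1.
  by move=> h; have /andP[h1 h2] := Os1 _ j h; rewrite !ltW.
have sinE k j : (f t)^-1 <= k -> sin (asin (Omega j * s k)) = Omega j * s k.
  by move=> h; apply: asinK; rewrite in_itv /= Os1'.
have cosE k j : (f t)^-1 <= k -> cos (asin (Omega j * s k)) = cosine (s k) j.
  by move=> h; rewrite cos_asin // Os1'.
have cont_asin j x : -1 < Omega j * x < 1 ->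
    {for x, continuous (fun x => asin (Omega j * x))}.
  move=> h; apply: (@continuous_comp _ _ _ ( *%R (Omega j))).
    by apply: cvgMl_tmp; exact: cvg_id.
  exact: continuous_asin.
have s_to0 : s k @[k --> +oo] --> (0 : R).
  (* As [coherence] decreases, [k^-1 = s k * coherence (s k)] is at least [s k * coherence t]. *)
  apply: (@squeeze_cvgr _ _ _ _ (fun=> 0) (fun k => (coherence t)^-1 * k^-1)).
  - near=> k.
    have h : (f t)^-1 <= k by near: k; apply: nbhs_pinfty_ge; exact: num_real.
    have [s0 st e] := sP _ h; rewrite (ltW s0) /= -e /f.
    rewrite mulrCA ler_peMr ?(ltW s0) // mulrC ler_pdivlMr ?mul1r ?coherence_gt0 //.
    move: st; rewrite le_eqVlt => /orP[/eqP->//|st].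
    by apply/ltW/ltr_coherence => //; exact: ltW.
  - exact: cvg_cst.
  - rewrite -[X in _ --> X](mulr0 (coherence t)^-1); apply: cvgMl_tmp.
    apply/gtr0_cvgV0; last exact: cvg_id.
    by apply: nbhs_pinfty_gt; exact: num_real.
exists (coherence \o s), (fun k j => asin (Omega j * s k)); split.
- move=> k h; have [s0 st e] := sP _ h; split.
  + by split; [exact: k0|apply: coherence_gt0 => j; apply: cs => //; exact: ltW].
  + by move=> j; rewrite cosE // sqrtr_ge0.
  + move=> j; rewrite sinE //=.
    transitivity (f (s k) * k * Omega j); last by rewrite /f; ring.
    by rewrite e mulVf ?mul1r // gt_eqF // k0.
  + by congr (_ * _); apply: eq_bigr => j _; rewrite cosE.
  + rewrite (eq_bigr (fun j => Omega j * s k)) => [|j _]; last by rewrite sinE.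
    by rewrite -mulr_suml sumO mul0r mulr0.
- move=> j; apply/subspace_continuousP => k /=; rewrite in_itv /= andbT => h.
  apply: (@cvg_comp _ _ _ s (fun x => asin (Omega j * x)) _ (nbhs (s k))).
    apply: (@cvg_comp _ _ _ (@GRing.inv R) g _ (within `[0, f t] (nbhs k^-1))).
      move=> U UV; rewrite /within /=.
      have kU : nbhs k (fun x => `[0, f t]%classic x^-1 -> U x^-1).
        exact: (@inv_continuous R k (lt0r_neq0 (k0 _ h)) _ UV).
      apply: (@filterS _ (nbhs k) _ _ _ _ kU) => x xU.
      rewrite /= in_itv /= andbT => /kV xV.
      by apply: xU; rewrite /= in_itv.
    have /subspace_continuousP /(_ k^-1) := cont_g.
    by apply; rewrite /= in_itv /=; exact: kV.
  exact/cont_asin/Os1.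
- move=> k1 k2 h1 h12.
  have h2 : (f t)^-1 <= k2 by apply: le_trans h1 (ltW h12).
  have [s10 s1t e1] := sP _ h1; have [s20 s2t e2] := sP _ h2.
  apply: ltr_coherence; [exact: ltW| |by move=> j; apply: cs => //; exact: ltW].
  rewrite ltNge le_eqVlt; apply/negP => /orP[/eqP es|h].
    move: e1; rewrite es e2 => /invr_inj ek; by move: h12; rewrite ek ltxx.
  have := f_incr _ _ (ltW s10) h s2t; rewrite e1 e2.
  by rewrite ltf_pV2 ?posrE ?k0 // ltNge ltW.
- rewrite -coherence0; apply: (@cvg_comp _ _ _ s coherence _ (nbhs (0 : R))) => //.
  exact: continuous_coherence.
- move=> j; rewrite -[X in _ --> X]asin0 -[X in asin X](mulr0 (Omega j)).
  apply: (@cvg_comp _ _ _ s (fun x => asin (Omega j * x)) _ (nbhs (0 : R))) => //.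
  by apply: cont_asin; rewrite mulr0; lra.
Unshelve. all: by end_near.
Qed.

End StableBranch.

Arguments cosine {R N} Omega s j.
Arguments coherence {R N} Omega s.
Arguments slope {R N} Omega s.

(** * Confinement of the angles by continuity along the branch *)

Section AngleRange.
Local Open Scope classical_set_scope.
Local Open Scope ring_scope.

(** An angle starting above [pi / 2] and tending to 0 would cross values with negative cosine. *)
Lemma angle_le_pihalf (R : realType) (k0 : R) (a : R -> R) :
  {within `[k0, +oo[, continuous a} ->
  (forall k, k0 <= k -> 0 <= cos (a k)) -> a k @[k --> +oo] --> (0 : R) ->
  a k0 <= pi / 2.
Proof.
move=> ca cos0 alim; rewrite leNgt; apply/negP => apos.
have pi0 := @pi_gt0 R.
have [K [kK aK]] : exists K, k0 <= K /\ a K < pi / 2.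
  apply: (@filter_ex _ (+oo : set_system R)).
  near=> k; split; first by near: k; apply: nbhs_pinfty_ge; exact: num_real.
  near: k; apply: (@cvgr_lt _ _ _ _ _ _ alim); lra.
(* Capping at [pi] keeps the intermediate value where the cosine is known to be negative, however
   large [a k0] is. *)
pose v := Num.min (a k0) pi.
have v1 : pi / 2 < v by rewrite lt_min apos; lra.
have v2 : v <= pi by rewrite ge_min lexx orbT.
have v3 : v <= a k0 by rewrite ge_min lexx.
have [k] : exists2 k, k \in `[k0, K] & a k = v.
  apply: IVT => //.
    apply: continuous_subspaceW ca => x; rewrite /= !in_itv /= andbT.
    by case/andP.
  rewrite ge_min le_max v3 andbT; apply/orP; right; lra.
rewrite in_itv /= => /andP[k1 _] ak.
have := cos0 _ k1; rewrite ak leNgt -cos_pihalf ltr_cos ?v1 // in_itv /=; lra.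
Unshelve. all: by end_near.
Qed.

Lemma norm_angle_le_pihalf (R : realType) (k0 : R) (a : R -> R) :
  {within `[k0, +oo[, continuous a} ->
  (forall k, k0 <= k -> 0 <= cos (a k)) -> a k @[k --> +oo] --> (0 : R) ->
  - (pi / 2) <= a k0 <= pi / 2.
Proof.
move=> ca cos0 alim; rewrite (@angle_le_pihalf _ k0 a) // andbT lerNl.
apply: (@angle_le_pihalf _ k0 (fun k => - a k)).
- by move=> x; apply: cvgN; exact: ca.
- by move=> k kk; rewrite cosN; exact: cos0.
- by rewrite -oppr0; exact: cvgN.
Qed.

End AngleRange.

(** * From the start of the stable branch to the critical equation *)

Lemma critical_state_angles (R : realType) (N : nat) (Omega : 'I_N -> R)
    (kappas lambdas : R) (alpha : 'I_N -> R) :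
  (exists j, Omega j != 0) -> \sum_(j < N) Omega j = 0 ->
  critical_state Omega kappas lambdas alpha ->
  [/\ exists2 s : R, 0 < s & forall j, sin (alpha j) = Omega j * s,
      forall j, - (pi / 2) < alpha j < pi / 2,
      \sum_j (cos (alpha j))^-1 = 2 * \sum_j cos (alpha j) &
      lambdas = N%:R^-1 * \sum_j cos (alpha j)].
Proof.
move=> Onz sumO [[lam [alp [[pl cont lmono llim alim] elam ealp]]] nobranch].
have [t t0 [c0 sl]] := exists_critical _ _ _ Onz.
have [/= [kap0 lam0] cos0 OE lamE sinE] := pl _ (lexx kappas).
rewrite elam in lam0 OE lamE.
have ealp' : alp kappas = alpha by apply/funext => j; exact: ealp.
rewrite ealp' in cos0 OE lamE sinE.
pose s := (lambdas * kappas)^-1.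
have s0 : 0 < s by rewrite invr_gt0 mulr_gt0.
have sE j : sin (alpha j) = Omega j * s.
  by rewrite OE /s; field; rewrite !gt_eqF.
have c2 j : cos (alpha j) ^+ 2 = 1 - Omega j ^+ 2 * s ^+ 2.
  by rewrite -exprMn -sE -(cos2Dsin2 (alpha j)); ring.
(* The branch starting at the maximum t of s * coherence s cannot begin before
   kappas, whereas s <> t would give s * coherence s a smaller value. *)
have st : s = t.
  apply/eqP; apply/negPn/negP => st.
  have := coherence_tangent _ _ _ Onz s t _ (ltW s0) (ltW t0) st c0 c2.
  rewrite -lamE sl !mulr0 addr0 => h.
  have ksE : s * lambdas = kappas^-1 by rewrite /s; field; rewrite !gt_eqF.
  apply: (nobranch (t * coherence Omega t)^-1).
    have ft0 : 0 < t * coherence Omega t.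
      by apply: le_lt_trans h; rewrite mulr_ge0 // ltW.
    by rewrite -[ltRHS]invrK ltf_pV2 ?posrE ?invr_gt0 // -ksE.
  exact: stable_branch_from_critical.
have cE j : cos (alpha j) = cosine Omega t j.
  apply/eqP; rewrite -(eqrXn2 (n := 2)) ?(ltW (c0 j)) //.
  by rewrite c2 st sqr_cosine.
split=> //.
- by exists s.
- move=> j.
  have /andP[h1 h2] : - (pi / 2) <= alpha j <= pi / 2.
    rewrite -ealp; apply: (norm_angle_le_pihalf _ _ (fun k => alp k j)) => //.
    by move=> k /pl[].
  have cj : 0 < cos (alpha j) by rewrite cE.
  rewrite !lt_neqAle h1 h2 !andbT; apply/andP; split; apply/eqP => e.
    by move: cj; rewrite -e cosN cos_pihalf ltxx.
  by move: cj; rewrite e cos_pihalf ltxx.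
- apply/eqP; rewrite -subr_eq0 -oppr_eq0 opprB mulr_sumr -sumrB.
  by rewrite -[X in _ == X]sl; apply/eqP; apply: eq_bigr => j _; rewrite cE.
Qed.

(** * Configurations with two frequencies *)

Lemma sum_step (R : realFieldType) (N j : nat) (a b : R) : (j <= N)%N ->
  \sum_(i < N) (if (i < j)%N then a else b) = j%:R * a + (N - j)%:R * b.
Proof.
move=> jN; rewrite -(big_mkord xpredT (fun i => if (i < j)%N then a else b)).
rewrite (big_cat_nat _ jN) //=; congr (_ + _).
  rewrite (@eq_big_nat _ _ _ _ _ _ (fun=> a)) => [|i /andP[_ ->//]].
  by rewrite sumr_const_nat subn0 mulr_natl.
rewrite (@eq_big_nat _ _ _ _ _ _ (fun=> b)) => [|i /andP[ji _]].
  by rewrite sumr_const_nat mulr_natl.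
by rewrite ltnNge ji.
Qed.

Section TwoFrequencies.
Variables (R : realType) (N : nat) (hN : (2 <= N)%N) (Omega : 'I_N -> R).
Hypothesis Omega_decr : forall i j : 'I_N, (i <= j)%N -> Omega j <= Omega i.
Hypothesis Omega_neq0 : exists j, Omega j != 0.
Hypothesis sum_Omega : \sum_(j < N) Omega j = 0.
Let i1 := first_idx hN.
Let iN := last_idx hN.

Lemma le_Omega_first i : Omega i <= Omega i1.
Proof. exact: Omega_decr. Qed.

Lemma ge_Omega_last i : Omega iN <= Omega i.
Proof. by apply: Omega_decr; rewrite /= subn1 -ltnS prednK // (ltn_trans _ hN). Qed.

Lemma Omega_first_gt0 : 0 < Omega i1.
Proof.
rewrite ltNge; apply/negP => h.
have [j /eqP[]] := Omega_neq0.
have : \sum_(j < N) (- Omega j) = 0 by rewrite sumrN sum_Omega oppr0.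
move/eqP; rewrite psumr_eq0 => [/allP /(_ j (mem_index_enum _))|i _].
  by rewrite /= oppr_eq0 => /eqP.
by rewrite oppr_ge0 (le_trans (le_Omega_first i)).
Qed.

Lemma Omega_last_lt0 : Omega iN < 0.
Proof.
rewrite ltNge; apply/negP => h.
have [j /eqP[]] := Omega_neq0.
move/eqP: sum_Omega; rewrite psumr_eq0 => [/allP /(_ j (mem_index_enum _))|i _].
  by move=> /eqP.
by rewrite (le_trans h) // ge_Omega_last.
Qed.

Lemma two_frequencies_of_extremes :
  (forall i, Omega i = Omega i1 \/ Omega i = Omega iN) ->
  exists j, two_frequencies Omega j (Omega i1) (- Omega iN).
Proof.
move=> ext.
have p := Omega_first_gt0; have n := Omega_last_lt0.
(* [j] will be the least index of a negative frequency; the last index shows that there is one. *)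
have exP : exists n, [exists i : 'I_N, (i == n :> nat) && (Omega i < 0)].
  by exists iN; apply/existsP; exists iN; rewrite eqxx.
case: (ex_minnP exP) => j /existsP[ij /andP[/eqP ijj Oj]] jmin.
have lt_j (i : 'I_N) : (i < j)%N -> Omega i = Omega i1.
  move=> ilt; case: (ext i) => // e.
  have : (j <= i)%N by apply: jmin; apply/existsP; exists i; rewrite eqxx e n.
  by rewrite leqNgt ilt.
have ge_j (i : 'I_N) : (j <= i)%N -> Omega i = Omega iN.
  move=> ji; case: (ext i) => // e.
  have : Omega i <= Omega ij by apply: Omega_decr; rewrite ijj.
  by rewrite e leNgt (lt_trans Oj p).
have jN : (j < N)%N by rewrite -ijj.
exists j; split => //.
- rewrite jN andbT lt0n; apply/eqP => j0.
  have : Omega i1 = Omega iN by apply: ge_j; rewrite j0.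
  by move=> e; move: p; rewrite e ltNge ltW.
- by rewrite opprK gt_eqF // (lt_trans n p).
- by move=> i /ge_j ->; rewrite opprK.
apply/eqP; rewrite -subr_eq0 mulrN opprK -(sum_step _ _ _ _ _ (ltnW jN)).
apply/eqP; rewrite -[RHS]sum_Omega; apply: eq_bigr => i _.
by case: ltnP => [/lt_j|/ge_j].
Qed.

End TwoFrequencies.

(** * The constant in the upper bound on the opening *)

Section Width.
Variables (R : realType) (N : nat).
Hypothesis N_ge2 : (2 <= N)%N.

(** The positive root of [4 * x ^+ 2 + (N - 2) * x - 2], that is, the [x] solving the critical
    equation when two cosines equal [x] and the other [N - 2] equal 1. *)
Definition half_width_cos : R :=
  (- N%:R + 2 + Num.sqrt (N%:R ^+ 2 - 4 * N%:R + 36)) / 8.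
Let g := half_width_cos.

Let radicandE :
  N%:R ^+ 2 - 4 * N%:R + 36 = (N%:R - 2) ^+ 2 + 32 :> R.
Proof. ring. Qed.

Lemma half_width_cos_root : 4 * g ^+ 2 + (N%:R - 2) * g - 2 = 0.
Proof.
have h : 0 <= (N%:R - 2) ^+ 2 + 32 :> R by rewrite addr_ge0 ?sqr_ge0.
rewrite /g /half_width_cos radicandE.
have := sqr_sqrtr h; set q := Num.sqrt _ => q2.
have -> : 4 * ((- N%:R + 2 + q) / 8) ^+ 2 + (N%:R - 2) * ((- N%:R + 2 + q) / 8) - 2 =
  (q ^+ 2 - ((N%:R - 2) ^+ 2 + 32)) / 16 by field.
by rewrite q2 subrr mul0r.
Qed.

Lemma half_width_cos_gt0 : 0 < g.
Proof.
rewrite /g /half_width_cos radicandE divr_gt0 //.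
have N2 : 2 <= N%:R :> R by rewrite ler_nat.
have h : (0 : R) <= N%:R - 2 by rewrite subr_ge0.
have : N%:R - 2 < Num.sqrt ((N%:R - 2) ^+ 2 + 32) :> R; last lra.
rewrite -[ltLHS](ger0_norm h) -sqrtr_sqr ltr_sqrt ?ltrDl //.
by rewrite ltr_wpDl ?sqr_ge0.
Qed.

Lemma half_width_cos_lt1 : g < 1.
Proof.
have N2 : 2 <= N%:R :> R by rewrite ler_nat.
have := half_width_cos_root; have := half_width_cos_gt0; nra.
Qed.

Lemma half_width_cos_le (h : R) : 0 < h -> 0 <= 4 * h ^+ 2 + (N%:R - 2) * h - 2 ->
  g <= h.
Proof.
have N2 : 2 <= N%:R :> R by rewrite ler_nat.
have := half_width_cos_root; have := half_width_cos_gt0 => g0 ge h0 hh.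
rewrite leNgt; apply/negP => hg; nra.
Qed.

Lemma acos_half_width : 0 <= acos g < pi / 2.
Proof.
have g0 := half_width_cos_gt0; have g1 := half_width_cos_lt1.
have gb : -1 <= g <= 1 by lra.
have pi0 := @pi_gt0 R.
rewrite acos_ge0 //=.
have := acos_lepi gb; have := acos_ge0 gb => a0 api.
rewrite -ltr_cos ?in_itv /= ?a0 ?api //; last lra.
by rewrite cos_pihalf acosK // in_itv.
Qed.

End Width.

Lemma unit_circle_slope_inj (R : realFieldType) (x y c d : R) :
  0 < c -> 0 < d -> c ^+ 2 + x ^+ 2 = 1 -> d ^+ 2 + y ^+ 2 = 1 ->
  x / c = y / d -> x = y.
Proof.
move=> c0 d0 hc hd e.
have e' : x * d = y * c.
  have -> : x * d = x / c * (c * d) by field; rewrite gt_eqF.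
  by rewrite e; field; rewrite gt_eqF.
have cd : c = d.
  apply/eqP; rewrite -(eqrXn2 (n := 2)) ?ltW //; apply/eqP.
  rewrite -[c ^+ 2]mulr1 -[d ^+ 2]mulr1 -{1}hd -hc.
  transitivity (c ^+ 2 * d ^+ 2 + (y * c) ^+ 2); first ring.
  by rewrite -e'; ring.
by move: e'; rewrite cd => /mulIf; apply; rewrite gt_eqF.
Qed.

Lemma sqr_two_values (R : realFieldType) (x y a : R) :
  x ^+ 2 = a -> y ^+ 2 = a -> x = y \/ x = - y.
Proof.
by move=> hx hy; have /eqP := hx; rewrite -hy eqf_sqr => /orP[] /eqP; [left|right].
Qed.

(** * The critical state *)

Section CriticalState.
Variables (R : realType) (N : nat) (hN : (2 <= N)%N).
Variables (Omega alpha : 'I_N -> R) (s : R).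
Hypothesis Omega_decr : forall i j : 'I_N, (i <= j)%N -> Omega j <= Omega i.
Hypothesis sum_Omega : \sum_(j < N) Omega j = 0.
Hypothesis s_gt0 : 0 < s.
Hypothesis sinE : forall j, sin (alpha j) = Omega j * s.
Hypothesis alpha_range : forall j, - (pi / 2) < alpha j < pi / 2.
Hypothesis critical : \sum_j (cos (alpha j))^-1 = 2 * \sum_j cos (alpha j).
Let i1 := first_idx hN.
Let iN := last_idx hN.
Let S := \sum_j cos (alpha j).

Let N_gt0 : (0 < N)%N := ltnW hN.
Let cos_gt0 j : 0 < cos (alpha j). Proof. exact: cos_gt0_pihalf. Qed.
Let sum_sin : \sum_j sin (alpha j) = 0.
Proof. by rewrite (eq_bigr _ (fun j _ => sinE j)) -mulr_suml sum_Omega mul0r. Qed.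
Let circle j := cos2Dsin2 (alpha j).

Let Omega_eq i j : sin (alpha i) = sin (alpha j) -> Omega i = Omega j.
Proof. by rewrite !sinE => /mulIf; apply; rewrite gt_eqF. Qed.

Lemma alpha_le (i j : 'I_N) : Omega i <= Omega j -> alpha i <= alpha j.
Proof.
move=> h; rewrite leNgt; apply/negP => h'.
have /andP[a1 a2] := alpha_range i; have /andP[b1 b2] := alpha_range j.
move: h'; rewrite -ltr_sin ?in_itv /= ?ltW //.
by rewrite !sinE ltr_pM2r // ltNge h.
Qed.

Lemma tangent_le (i j : 'I_N) : Omega i <= Omega j ->
  sin (alpha i) / cos (alpha i) <= sin (alpha j) / cos (alpha j).
Proof.
move=> h; have hij := alpha_le i j h.
have /andP[a1 a2] := alpha_range i; have /andP[b1 b2] := alpha_range j.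
rewrite ler_pdivrMr // mulrAC ler_pdivlMr //.
have : 0 <= sin (alpha j - alpha i) by rewrite sin_ge0_pi //; lra.
rewrite sinB; lra.
Qed.

Let tan_range j : sin (alpha iN) / cos (alpha iN) <= sin (alpha j) / cos (alpha j)
  <= sin (alpha i1) / cos (alpha i1).
Proof.
by rewrite !tangent_le // ?le_Omega_first // ge_Omega_last.
Qed.

Let cos_openingE : cos (opening hN alpha) = cos (alpha i1) * cos (alpha iN) *
  (1 + sin (alpha i1) / cos (alpha i1) * (sin (alpha iN) / cos (alpha iN))).
Proof.
rewrite /opening cosB -/i1 -/iN; field.
by rewrite !gt_eqF.
Qed.

Let opening_range : 0 <= opening hN alpha < pi.
Proof.
have /andP[a1 a2] := alpha_range i1; have /andP[b1 b2] := alpha_range iN.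
have : alpha iN <= alpha i1 by apply: alpha_le; exact: le_Omega_first.
rewrite /opening -/i1 -/iN; lra.
Qed.

Lemma opening_ge : pi / 2 <= opening hN alpha.
Proof.
have : cos (opening hN alpha) <= 0.
  rewrite cos_openingE pmulr_rle0 ?mulr_gt0 // addrC -lerBrDr add0r.
  exact: (tangent_product_ge1 _ _ _ _ cos_gt0 circle sum_sin critical).
apply: contraTT; rewrite -!ltNge => h; apply: cos_gt0_pihalf.
have /andP[h0 _] := opening_range; have := @pi_gt0 R; lra.
Qed.

Lemma opening_eq : opening hN alpha = pi / 2 ->
  forall j, Omega j = Omega i1 \/ Omega j = Omega iN.
Proof.
move=> e j.
have : cos (opening hN alpha) = 0 by rewrite e cos_pihalf.
move/eqP; rewrite cos_openingE mulf_eq0 gt_eqF ?mulr_gt0 //= addrC addr_eq0 => /eqP tt.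
have [h|h] := tangent_product_eq1 _ _ _ _ cos_gt0 circle sum_sin critical
  _ _ tan_range tt j.
  by left; apply: Omega_eq; apply: unit_circle_slope_inj h.
by right; apply: Omega_eq; apply: unit_circle_slope_inj h.
Qed.

Lemma opening_le : opening hN alpha <= 2 * acos (half_width_cos R N).
Proof.
have pi0 := @pi_gt0 R.
have /andP[wid_ge0 wid_lt] := opening_range.
have /andP[A0 A1] := acos_half_width R N hN.
have g0 := half_width_cos_gt0 R N hN; have g1 := half_width_cos_lt1 R N hN.
pose u := opening hN alpha / 2; pose v := (alpha i1 + alpha iN) / 2.
have e1 : alpha i1 = u + v by rewrite /u /v /opening -/i1 -/iN; field.
have eN : alpha iN = v - u by rewrite /u /v /opening -/i1 -/iN; field.
have cu0 : 0 <= cos u by apply: cos_ge0_pihalf; rewrite /u; lra.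
(* u |-> 2 cos u - 1 / cos u is concave, so replacing both extreme angles by
   half the opening only weakens two_cosines_ge. *)
set g := half_width_cos R N in A0 A1 g0 g1 *.
suff gu : g <= cos u.
  suff : u <= acos g by rewrite /u; lra.
  rewrite leNgt; apply/negP => h.
  have : cos u < cos (acos g) by rewrite ltr_cos // in_itv /= /u; lra.
  by rewrite acosK ?ltNge ?gu // in_itv /=; lra.
(* The mean of the extreme cosines equals [cos u * cos v], so it is at most [cos u]. *)
pose h := (cos (alpha i1) + cos (alpha iN)) / 2.
have hu : h <= cos u.
  have -> : h = cos u * cos v by rewrite /h e1 eN cosD cosB; field.
  by rewrite ler_piMr // cos_le1.
have h0 : 0 < h by rewrite divr_gt0 // addr_gt0.
apply: le_trans hu; apply: half_width_cos_le => //.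
have i1N : i1 != iN by rewrite -val_eqE /= subn1 neq_ltn -ltnS prednK // hN.
have := two_cosines_ge _ _ _ _ cos_gt0 circle critical _ _ i1N.
(* Convexity of the inverse: it merges the two terms of [two_cosines_ge] into [4 * h - 2 / h]. *)
have harm : 2 / h <= (cos (alpha i1))^-1 + (cos (alpha iN))^-1.
  rewrite -subr_ge0.
  have -> : (cos (alpha i1))^-1 + (cos (alpha iN))^-1 - 2 / h =
    (cos (alpha i1) - cos (alpha iN)) ^+ 2 /
    (cos (alpha i1) * cos (alpha iN) * (cos (alpha i1) + cos (alpha iN))).
    by rewrite /h; field; rewrite !gt_eqF // addr_gt0.
  by rewrite divr_ge0 ?sqr_ge0 // ltW // !mulr_gt0 // addr_gt0.
have hE : cos (alpha i1) + cos (alpha iN) = 2 * h by rewrite /h; field.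
move=> k.
have {}k : 0 <= 4 * h - 2 / h + (N%:R - 2) by lra.
have -> : 4 * h ^+ 2 + (N%:R - 2) * h - 2 = h * (4 * h - 2 / h + (N%:R - 2)).
  by field; rewrite gt_eqF.
by rewrite mulr_ge0 // ltW.
Qed.

(** Equality in [sum_cos_ge] makes all cosines equal, hence all sines equal up to sign. *)
Lemma minimal_coherence : 2 * S ^+ 2 = N%:R ^+ 2 ->
  forall j, Omega j = Omega i1 \/ Omega j = - Omega i1.
Proof.
move=> hS j.
have cE := sum_cos_eq _ _ _ cos_gt0 critical N_gt0 hS.
have sq i : sin (alpha i) ^+ 2 = 1 - (S / N%:R) ^+ 2.
  by rewrite -(cE i) -(circle i); ring.
have [h|h] := sqr_two_values _ _ _ _ (sq j) (sq i1); first by left; apply: Omega_eq.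
right; move: h; rewrite !sinE -mulNr => /mulIf; apply; rewrite gt_eqF //.
Qed.

End CriticalState.

(** * Bounds on the opening and the order parameter, with their extremal cases *)

Theorem lemma6p2 (R : realType) (N : nat) (hN : (2 <= N)%N)
    (Omega : 'I_N -> R)
    (hdecr : forall i j : 'I_N, (i <= j)%N -> Omega j <= Omega i)
    (hnz : exists j, Omega j != 0)
    (hsum : \sum_(j < N) Omega j = 0)
    (kappas lambdas : R) (alpha : 'I_N -> R)
    (hcrit : critical_state Omega kappas lambdas alpha) :
  let width : R :=
    2 * acos ((- N%:R + 2 + Num.sqrt (N%:R ^+ 2 - 4 * N%:R + 36)) / 8) in
  let lambda_max : R :=
    (1 + (N%:R - 1) ^+ 2) / (N%:R * Num.sqrt ((N%:R - 1) ^+ 2 + 1)) in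
  let lambda_min : R := Num.sqrt 2 / 2 in
  [/\ pi > width, width >= opening hN alpha & opening hN alpha >= pi / 2]
  /\ (opening hN alpha = pi / 2 ->
        exists (j : nat) (M1 M2 : R), two_frequencies Omega j M1 M2)
  /\ (lambda_max >= lambdas /\ lambdas >= lambda_min)
  /\ (lambdas = lambda_min ->
        ~~ odd N /\ exists M1 M2 : R, two_frequencies Omega N./2 M1 M2)
  /\ (forall M1 M2 : R, two_frequencies Omega 1 M1 M2 -> lambdas = lambda_max).
Proof.
move=> width lambda_max lambda_min.
have [[s s0 sE] range crit lamE] := critical_state_angles _ _ _ _ _ _ hnz hsum hcrit.
have N0 : (0 < N)%N := ltnW hN.
have NR : 0 < N%:R :> R by rewrite ltr0n.
have c0 j : 0 < cos (alpha j) by exact: cos_gt0_pihalf.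
have circle j := cos2Dsin2 (alpha j).
have sum_sin : \sum_j sin (alpha j) = 0.
  by rewrite (eq_bigr _ (fun j _ => sE j)) -mulr_suml hsum mul0r.
set S := \sum_j cos (alpha j) in lamE crit.
have S0 : 0 < S by exact: sum_cos_gt0.
have SE : S = N%:R * lambdas by rewrite lamE mulrA mulfV ?mul1r // gt_eqF.
pose D := Num.sqrt ((N%:R - 1) ^+ 2 + 1 : R).
have D2 : D ^+ 2 = (N%:R - 1) ^+ 2 + 1 by rewrite sqr_sqrtr // addr_ge0 ?sqr_ge0.
have D0 : 0 < D by rewrite sqrtr_gt0 ltr_wpDl ?sqr_ge0.
have maxE : lambda_max = N%:R^-1 * D.
  by rewrite /lambda_max -/D [1 + _]addrC -D2; field; rewrite !gt_eqF.
have r2 : Num.sqrt 2 ^+ 2 = 2 :> R by rewrite sqr_sqrtr.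
have r0 : 0 < Num.sqrt 2 :> R by rewrite sqrtr_gt0.
split; [split|split; [|split; [split|split]]].
- have /andP[_ h] := acos_half_width R N hN; rewrite /half_width_cos in h.
  rewrite /width; lra.
- exact: (opening_le _ _ _ Omega _ s).
- exact: (opening_ge _ _ _ Omega _ s).
- move=> /(opening_eq _ _ _ Omega _ s hdecr hsum s0 sE range crit).
  by case/two_frequencies_of_extremes => // j hj; exists j; do 2 eexists; exact: hj.
- rewrite maxE lamE ler_pM2l ?invr_gt0 // -ler_sqr ?nnegrE ?(ltW S0) ?(ltW D0) // D2.
  exact: (sum_cos_le _ _ (fun j => sin (alpha j))).
- have := sum_cos_ge _ _ _ c0 crit N0.
  rewrite -/S SE exprMn mulrCA ler_pMr ?exprn_gt0 // => h.
  have l0 : 0 <= lambdas by rewrite lamE mulr_ge0 ?invr_ge0 ?(ltW NR) ?(ltW S0).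
  rewrite -ler_sqr ?nnegrE // ?divr_ge0 ?(ltW r0) //.
  rewrite expr_div_n r2; lra.
- move=> lmin.
  have hS : 2 * S ^+ 2 = N%:R ^+ 2.
    by rewrite SE lmin /lambda_min exprMn expr_div_n r2; field.
  have pm := minimal_coherence _ _ hN Omega _ s s0 sE range crit hS.
  have p := Omega_first_gt0 _ _ hN _ hdecr hnz hsum.
  have n := Omega_last_lt0 _ _ hN _ hdecr hnz hsum.
  (* The last frequency is negative, hence the opposite of the first; balancing [j] copies of one
     against [N - j] of the other then forces [N = 2 * j]. *)
  have lE : Omega (last_idx hN) = - Omega (first_idx hN).
    by case: (pm (last_idx hN)) => // e; move: n; rewrite e ltNge ltW.
  have [j tf] : exists j, two_frequencies Omega j
      (Omega (first_idx hN)) (- Omega (last_idx hN)).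
    by apply: two_frequencies_of_extremes => // i; rewrite lE.
  have [/andP[_ jN] _ _ _] := tf.
  rewrite lE opprK => /(mulIf (lt0r_neq0 p)) /eqP; rewrite eqr_nat => /eqP jE.
  have NE : N = j.*2 by rewrite -addnn {2}jE subnKC // ltnW.
  split; first by rewrite NE odd_double.
  have -> : N./2 = j by rewrite NE doubleK.
  by do 2 eexists; exact: tf.
- move=> M1 M2 [_ M12 h1 h2 e]; rewrite mul1r natrB // in e.
  (* If [M2] vanished then so would [M1], and the two frequencies would coincide. *)
  have M20 : M2 != 0.
    by apply: contraNneq M12 => M20; rewrite e M20 mulr0 oppr0.
  have : S ^+ 2 = D ^+ 2.
    rewrite D2; apply: (sum_cos_one_vs_rest _ _ _ _ c0 circle crit
      (first_idx hN) (M2 * s)) => //.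
    + by rewrite mulf_neq0 // gt_eqF.
    + by rewrite sE h1 // e mulrA.
    + move=> j j1; rewrite sE h2 ?mulNr // lt0n.
      by apply: contraNneq j1 => j0; apply/eqP/val_inj.
  move/eqP; rewrite eqrXn2 ?(ltW S0) ?(ltW D0) // => /eqP SD.
  by rewrite maxE lamE SD.
Qed.
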